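(* Let $d\ge2$, $x\in[0,1]^d$ and $N\ge d$ be an integer, and let $\mathcal V(x)$ be the cell containing $x$ after $N$ steps of the centered random tree. Then, with probability at least $1/14$, $$\frac{h_+(\mathcal V(x))}{h_-(\mathcal V(x))}\ \ge\ 2^{\sqrt{N/d}}.$$
   Context: Centered random tree around $x$: let $D_1,D_2,\dots$ be i.i.d. uniformly distributed on $\{1,\dots,d\}$. Start from the cell $[0,1]^d$. At step $i$, the side of the current cell in direction $D_i$ is cut at its midpoint, producing two new cells, and the one containing $x$ becomes the current cell (so its side in direction $D_i$ is halved and the others are unchanged). For a hyper-rectangle $A$, $h_-(A)$ and $h_+(A)$ denote its smallest and largest side lengths. *)

(* Defs.v *)
From mathcomp Require Import all_boot all_order all_algebra finmap.
From mathcomp Require Import all_classical all_reals all_analysis.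
Set Implicit Arguments.
Unset Strict Implicit.
Unset Printing Implicit Defensive.
Import Order.TTheory GRing.Theory Num.Theory.
Import numFieldNormedType.Exports.
Local Open Scope classical_set_scope.
Local Open Scope ring_scope.

Section Rectangles.
Variables (R : realType) (d : nat).

Record hrect := HRect { lo : 'rV[R]_d ; hi : 'rV[R]_d }.

Implicit Types (A : hrect) (j : 'I_d) (x : 'rV[R]_d).

Definition in_hrect x A : bool :=
  [forall j, lo A ord0 j <= x ord0 j <= hi A ord0 j].

Definition side A j : R := hi A ord0 j - lo A ord0 j.

(* For 0 < d the range below is finite and nonempty, so the infimum and the
   supremum are attained: they are the smallest and the largest side. *)
Definition h_minus A : R := inf (range (side A)).
Definition h_plus A : R := sup (range (side A)).

Definition unit_cube : hrect := HRect (const_mx 0) (const_mx 1).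

Definition midpoint A j : R := (lo A ord0 j + hi A ord0 j) / 2.

Definition lower_half A j : hrect :=
  HRect (lo A) (\row_k if k == j then midpoint A j else hi A ord0 k).

Definition upper_half A j : hrect :=
  HRect (\row_k if k == j then midpoint A j else lo A ord0 k) (hi A).

(* Rectangles are closed, so a point on the cut lies in both halves; it is then
   sent to the lower one. The two halves have the same side lengths, so this
   choice has no effect on the side lengths of the successive cells. *)
Definition child x A j : hrect :=
  if in_hrect x (lower_half A j) then lower_half A j else upper_half A j.

(* The sequence of cut directions is indexed from 0: dir i is the direction
   of the (i+1)-st cut. *)
Fixpoint cell x (dir : nat -> 'I_d) (n : nat) : hrect :=
  if n is m.+1 then child x (cell x dir m) (dir m) else unit_cube.

Lemma in_cell x (dir : nat -> 'I_d) n :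
  in_hrect x unit_cube -> in_hrect x (cell x dir n).
Proof.
move=> x01; elim: n => [//|n IH] /=; rewrite /child; case: ifPn => // Nlow.
have inA k : lo (cell x dir n) ord0 k <= x ord0 k <= hi (cell x dir n) ord0 k.
  by move/forallP: IH; apply.
apply/forallP => k /=; rewrite mxE; case: eqP => [->|_]; last exact: inA.
case/andP: (inA (dir n)) => _ ->; rewrite andbT leNgt.
apply: contra Nlow => lt_mid; apply/forallP => l /=; rewrite mxE.
case: eqP => [->|_]; last exact: inA.
by case/andP: (inA (dir n)) => -> _; exact: ltW.
Qed.

End Rectangles.

Section DiscreteRandomVariables.
Context {disp : measure_display} {T : measurableType disp} {R : realType}
  (P : probability T R) {S : finType} {I : choiceType}.
Implicit Type X : I -> T -> S.

(* The finite type S carries the discrete sigma-algebra: every subset of S is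
   measurable. *)
Definition discrete_rvs X :=
  forall (i : I) (B : set S), measurable (X i @^-1` B).

Definition mutually_independent X :=
  forall (J : {fset I}) (B : I -> set S),
    P (\bigcap_(i in [set` J]) (X i @^-1` B i)) =
      (\prod_(i <- J) P (X i @^-1` B i))%E.

Definition uniformly_distributed X :=
  forall (i : I) (s : S), P (X i @^-1` [set s]) = (#|S|%:R^-1)%:E.

End DiscreteRandomVariables.

(* Main.v *)
Require Import Defs.
From mathcomp Require Import all_boot all_order all_algebra finmap ring lra.
From mathcomp Require Import all_classical all_reals all_analysis.
Import Order.TTheory GRing.Theory Num.Theory.
Import numFieldNormedType.Exports.
Local Open Scope classical_set_scope.
Local Open Scope ring_scope.

(** Fix two of the $d$ directions, $j$ and $k$, and let $K_j$, $K_k$ be the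
    numbers of cuts that they receive among the first $N$. Since a cut halves
    one side, the side in direction $j$ is $2^{-K_j}$, so the ratio of the
    extreme sides is at least $2^{|K_j - K_k|}$ ([shape_ge]). It is therefore
    enough that $(K_j - K_k)^2 \ge \lambda := N/d$ with probability at least
    $1/14$.

    Now $Z = K_j - K_k$ is a sum of $N$ independent steps, each equal to $1$ or
    $-1$ with probability $1/d$ and to $0$ otherwise. The odd moments of a step
    vanish, so $E Z^2 = 2 \lambda$ and
    $E Z^4 = 2 \lambda + 3 N (N - 1) (2/d)^2 \le 2 \lambda + 12 \lambda^2
     \le 14 \lambda^2$,
    the last step because $N \ge d$ means $\lambda \ge 1$. The Paley-Zygmund
    inequality applied to $Z^2$ at half of its mean gives
    $\lambda^2 \le P(Z^2 \ge \lambda) \cdot 14 \lambda^2$, which is the claim.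

    The first $N$ directions are uniform on the $d^N$ words of length $N$
    ([probability_tuple]), so all the moments are averages over a finite type;
    they are computed by induction on the length of the word. *)

(** * Averages over a finite type *)

Section Mean.
Context {R : realFieldType}.

Definition mean {I : finType} (f : I -> R) : R := (\sum_i f i) / #|I|%:R.

Lemma eq_mean (I : finType) (f g : I -> R) : f =1 g -> mean f = mean g.
Proof. by move=> fg; rewrite /mean (eq_bigr _ (fun i _ => fg i)). Qed.

Lemma meanD (I : finType) (f g : I -> R) :
  mean (fun i => f i + g i) = mean f + mean g.
Proof. by rewrite /mean big_split mulrDl. Qed.

Lemma meanZ (I : finType) (c : R) (f : I -> R) :
  mean (fun i => c * f i) = c * mean f.
Proof. by rewrite /mean -mulr_sumr mulrA. Qed.

Lemma mean_cst (I : finType) (c : R) : (0 < #|I|)%N -> mean (fun _ : I => c) = c.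
Proof.
move=> I0; rewrite /mean sumr_const -[c *+ _]mulr_natr mulfK // pnatr_eq0.
by rewrite -lt0n.
Qed.

Lemma ler_mean (I : finType) (f g : I -> R) :
  (forall i, f i <= g i) -> mean f <= mean g.
Proof. by move=> fg; rewrite ler_wpM2r ?invr_ge0 ?ler0n// ler_sum. Qed.

Lemma mean_indic (I : finType) (Q : pred I) :
  mean (fun i => (Q i)%:R) = #|Q|%:R / #|I|%:R.
Proof. by rewrite /mean -natr_sum -sum1_card [in LHS]big_mkcond [in RHS]big_mkcond. Qed.

Lemma mean_tuple0 (S : finType) (F : 0.-tuple S -> R) : mean F = F [tuple].
Proof.
rewrite /mean (eq_bigr (fun=> F [tuple])) => [|t _]; last by rewrite tuple0.
by rewrite sumr_const card_tuple expn0 divr1.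
Qed.

Lemma mean_tupleS (S : finType) n (F : n.+1.-tuple S -> R) :
  mean F = mean (fun s => mean (fun t : n.-tuple S => F [tuple of s :: t])).
Proof.
rewrite /mean -mulr_suml !card_tuple expnSr natrM invfM mulrA pair_big /=.
congr (_ / _ / _).
rewrite (reindex (fun p : S * n.-tuple S => [tuple of p.1 :: p.2])) //=.
exists (fun t => (thead t, [tuple of behead t])) => [[s t] _|t _] /=.
  by rewrite theadE; congr (_, _); exact: val_inj.
by rewrite -tuple_eta.
Qed.

(** The Paley-Zygmund inequality for the uniform measure. Write $u$ for the
    excess of the mean of $Y$ over $\theta$ and $p$ for the proportion of points
    where $Y \ge \theta$. For every $s \ge 0$ one has pointwise
    $2 s (Y - \theta) \le Y^2 + s^2 1_{Y \ge \theta}$; averaging gives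
    $2 s u \le E Y^2 + s^2 p$, which is optimal at $s = u / p$. This replaces
    the Cauchy-Schwarz inequality. *)
Lemma paley_zygmund (I : finType) (Y : I -> R) (theta : R) :
  (0 < #|I|)%N -> 0 <= theta -> theta <= mean Y ->
  (mean Y - theta) ^+ 2 <=
    mean (fun i => (theta <= Y i)%R%:R) * mean (fun i => Y i ^+ 2).
Proof.
move=> I0 th0 thY; set p := mean (fun i => (theta <= Y i)%R%:R).
set m2 := mean (fun i => Y i ^+ 2); set u := mean Y - theta.
have u0 : 0 <= u by rewrite subr_ge0.
have p0 : 0 <= p by rewrite mulr_ge0 ?invr_ge0 ?ler0n// sumr_ge0.
have key s : 0 <= s -> 2 * s * u <= m2 + s ^+ 2 * p.
  move=> s0; rewrite mulrBr lerBlDl -meanZ.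
  have -> : 2 * s * theta = mean (fun _ : I => 2 * s * theta).
    by rewrite (@mean_cst I).
  rewrite -meanZ -!meanD; apply: ler_mean => i.
  have sth := mulr_ge0 s0 th0.
  case: (lerP theta (Y i)) => h /=.
    by rewrite mulr1; have := sqr_ge0 (Y i - s); nra.
  by have := sqr_ge0 (Y i); have := ler_wpM2l s0 (ltW h); nra.
(* If p = 0 then u must vanish, as otherwise a large s contradicts key. *)
have [p_eq0|p_neq0] := eqVneq p 0.
  have -> : u = 0.
    apply/eqP; rewrite eq_le u0 andbT leNgt; apply/negP => u_gt0.
    have m0 : 0 <= m2.
      by rewrite mulr_ge0 ?invr_ge0 ?ler0n// sumr_ge0// => i _; exact: sqr_ge0.
    have /key : 0 <= (m2 + 1) / u by rewrite divr_ge0 // ?ltW // ltr_wpDl.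
    by rewrite p_eq0 mulr0 addr0 -mulrA divfK ?gt_eqF //; lra.
  by rewrite p_eq0 mul0r expr2 mulr0.
have p_gt0 : 0 < p by rewrite lt_def p_neq0.
have := key (u / p); rewrite divr_ge0// => /(_ isT).
have -> : 2 * (u / p) * u = 2 * (u ^+ 2 / p) by field.
have -> : (u / p) ^+ 2 * p = u ^+ 2 / p by field.
move=> h; have : u ^+ 2 / p <= m2 by lra.
by rewrite ler_pdivrMr// mulrC.
Qed.

(** * Second and fourth moments of a sum of independent centered steps *)

Section Moments.
Variables (S : finType) (a : S -> R).
Hypotheses (S0 : (0 < #|S|)%N) (a1 : mean a = 0)
  (a3 : mean (fun s => a s ^+ 3) = 0).

Let Z {n} (t : n.-tuple S) : R := \sum_(s <- t) a s.

Let tuple_gt0 n : (0 < #|{: n.-tuple S}|)%N.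
Proof. by rewrite card_tuple expn_gt0 S0. Qed.

Lemma mean_sum_sqr n :
  mean (fun t : n.-tuple S => (\sum_(s <- t) a s) ^+ 2) =
  n%:R * mean (fun s => a s ^+ 2).
Proof.
elim: n => [|n IH]; first by rewrite mean_tuple0 big_nil expr0n mul0r.
have split_first s : mean (fun t : n.-tuple S => (\sum_(i <- s :: t) a i) ^+ 2) =
    a s ^+ 2 + (2 * mean (@Z n) * a s + n%:R * mean (fun s => a s ^+ 2)).
  rewrite -{}IH mulrAC -meanZ -(mean_cst _ (a s ^+ 2) (tuple_gt0 n)) -!meanD.
  by apply: eq_mean => t; rewrite big_cons /Z; ring.
rewrite mean_tupleS (eq_mean _ _ _ split_first) !meanD mean_cst// !meanZ a1.
by rewrite -[n.+1%:R]natr1; ring.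
Qed.

(** Expanding the fourth power of a new step plus the old sum, the terms that
    are odd in the step average to 0, so the fourth moment grows by
    $m_4 + 6 m_2 \cdot n m_2$; the factor $6 n$ sums up to $3 n (n - 1)$. *)
Lemma mean_sum_pow4 n :
  mean (fun t : n.-tuple S => (\sum_(s <- t) a s) ^+ 4) =
  n%:R * mean (fun s => a s ^+ 4) +
  3 * n%:R * (n%:R - 1) * mean (fun s => a s ^+ 2) ^+ 2.
Proof.
elim: n => [|n IH].
  by rewrite mean_tuple0 big_nil expr0n !mulr0 !mul0r addr0.
have split_first s : mean (fun t : n.-tuple S => (\sum_(i <- s :: t) a i) ^+ 4) =
    a s ^+ 4 + (4 * mean (@Z n) * a s ^+ 3 +
      (6 * mean (fun t : n.-tuple S => Z t ^+ 2) * a s ^+ 2 +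
        (4 * mean (fun t : n.-tuple S => Z t ^+ 3) * a s +
          mean (fun t : n.-tuple S => Z t ^+ 4)))).
  rewrite ![_ * mean _ * _]mulrAC -!meanZ.
  rewrite -(mean_cst _ (a s ^+ 4) (tuple_gt0 n)) -!meanD.
  by apply: eq_mean => t; rewrite big_cons /Z; ring.
rewrite mean_tupleS (eq_mean _ _ _ split_first) !meanD !mean_cst// !meanZ a1 a3.
rewrite IH mean_sum_sqr; rewrite -[n.+1%:R]natr1; ring.
Qed.

End Moments.
End Mean.

(** * The law of the first terms of a uniform independent sequence *)

Section UniformSequence.
Context {disp : measure_display} {T : measurableType disp} {R : realType}
  (P : probability T R) {S : finType} (X : nat -> T -> S).
Hypotheses (Xrv : discrete_rvs X) (Xindep : mutually_independent P X)
  (Xunif : uniformly_distributed P X).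

Let cylinder n (t : n.-tuple S) : set T :=
  [set w | [tuple X i w | i < n] = t].

(* Independence speaks of events indexed by natural numbers; onth gives the
   i-th letter of the word without a bound on i or a default letter. *)
Let cylinderE n (t : n.-tuple S) (B := fun i => [set s | onth t i = Some s]) :
  cylinder n t = \bigcap_(i in [set` [fset i | i in iota 0 n]%fset]) (X i @^-1` B i).
Proof.
apply/seteqP; split => w /=.
  move=> tE i /=; rewrite !inE /= mem_iota /= add0n => lin.
  by apply/(tnth_onth _ _ (Ordinal lin)); rewrite -tE tnth_mktuple.
move=> h; apply: eq_from_tnth => i; rewrite tnth_mktuple; apply/esym/tnth_onth.
by apply: h; rewrite /= !inE /= mem_iota /= add0n ltn_ord.
Qed.

Let measurable_cylinder n (t : n.-tuple S) : measurable (cylinder n t).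
Proof.
rewrite cylinderE; apply: fin_bigcap_measurable => [|i _]; last exact: Xrv.
exact: finite_fset.
Qed.

Let probability_cylinder n (t : n.-tuple S) :
  P (cylinder n t) = (#|{: n.-tuple S}|%:R^-1)%:E.
Proof.
rewrite cylinderE Xindep.
rewrite (eq_big_seq (fun=> (#|S|%:R^-1)%:E)); last first.
  move=> i; rewrite !inE /= mem_iota /= add0n => lin.
  rewrite -(Xunif i (tnth t (Ordinal lin))); congr (P (_ @^-1` _)).
  apply/seteqP; split => s /=.
    by move=> /(tnth_onth _ _ (Ordinal lin)).
  by move=> ->; apply/(tnth_onth _ _ (Ordinal lin)).
rewrite prodEFin big_const_seq count_predT.
rewrite (_ : size _ = n); last first.
  by rewrite card_imfset//= undup_id ?iota_uniq// size_iota.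
by rewrite iter_mulr_1 card_tuple natrX exprVn.
Qed.

(** By independence each word has probability $|S|^{-n}$, and the cylinders of
    distinct words are disjoint. As the event is a finite union of cylinders,
    it is measurable for every predicate on words. *)
Lemma probability_tuple n (Q : pred (n.-tuple S)) :
  P [set w | Q [tuple X i w | i < n]] = (#|Q|%:R / #|{: n.-tuple S}|%:R)%:E.
Proof.
have -> : [set w | Q [tuple X i w | i < n]] =
    \bigcup_(t in [set` enum Q]) cylinder n t.
  apply/seteqP; split => [w Qw|w [t + wt]]; last by rewrite /= mem_enum -wt.
  by exists [tuple X i w | i < n] => //=; rewrite mem_enum.
rewrite measure_fin_bigcup//; last first.
  by move=> t u _ _ [w []]; rewrite /cylinder /= => <- <-.
rewrite -fsbig_seq ?enum_uniq//.
rewrite (eq_bigr _ (fun t _ => probability_cylinder n t)) big_enum /=.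
by rewrite sumEFin sumr_const mulr_natl.
Qed.
End UniformSequence.

(** * Side lengths of the cells *)

Section Cells.
Context {R : realType} {d : nat}.
Implicit Types (x : 'rV[R]_d) (dir : nat -> 'I_d).

Lemma side_cell x dir n j :
  side (cell x dir n) j = 2 ^- count_mem j (mkseq dir n).
Proof.
elim: n => [|n IH]; first by rewrite /side /= !mxE subr0 expr0 invr1.
rewrite /mkseq -[in RHS](addn1 n) iotaD map_cat count_cat /= addn0 add0n -/(mkseq dir n).
rewrite exprD invfM -IH /child /side.
case: ifP => _ /=; rewrite !mxE /midpoint eq_sym;
  case: eqP => [->|_]; rewrite ?expr1 ?expr0 ?invr1 ?mulr1//; lra.
Qed.

Lemma cell_congr x dir dir' n :
  (forall i, (i < n)%N -> dir i = dir' i) -> cell x dir n = cell x dir' n.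
Proof.
elim: n => //= n IH e; rewrite IH ?e// => i lin.
by apply: e; exact: ltn_trans lin _.
Qed.

(** The set of sides lies between $2^{-n}$ and 1, so its infimum and supremum
    are genuine bounds and the infimum, a denominator here, is positive. *)
Lemma shape_ge x dir n j k :
  2 `^ ((count_mem j (mkseq dir n))%:R - (count_mem k (mkseq dir n))%:R) <=
  h_plus (cell x dir n) / h_minus (cell x dir n).
Proof.
set A := cell x dir n.
have sideE := side_cell x dir n; rewrite -/A in sideE.
have le1 l : side A l <= 1 by rewrite sideE invf_le1 ?exprn_gt0// exprn_ege1// ler1n.
have gen l : 2 ^- n <= side A l.
  rewrite sideE lef_pV2 ?posrE ?exprn_gt0// ler_eXn2l ?ltr1n//.
  by rewrite (leq_trans (count_size _ _))// size_mkseq.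
have n0 : 0 < 2 ^- n :> R by rewrite invr_gt0 exprn_gt0.
have hplus : side A k <= h_plus A.
  by apply: ub_le_sup; [exists 1 => _ [l _ <-] | exists k].
have hminus : h_minus A <= side A j.
  by apply: ge_inf; [exists (2 ^- n) => _ [l _ <-] | exists j].
have hminus0 : 0 < h_minus A.
  apply: (lt_le_trans n0); apply: lb_le_inf => [|_ [l _ <-]//].
  by exists (side A j), j.
rewrite powRB ?pnatr_eq0 ?implybT// !powR_mulrn//.
have -> : 2 ^+ count_mem j (mkseq dir n) = (side A j)^-1 by rewrite sideE invrK.
rewrite -sideE mulrC ler_pM// ?invr_ge0 ?(ltW (lt_le_trans n0 _))//.
by rewrite lef_pV2// posrE (lt_le_trans hminus0).
Qed.
End Cells.

(** * The difference of the numbers of cuts in two directions *)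

Section CountDifference.
Context {R : realFieldType} {S : finType} (j k : S).
Hypothesis jk : j != k.

Definition step (s : S) : R := (s == j)%:R - (s == k)%:R.

Lemma sum_step (r : seq S) :
  \sum_(s <- r) step s = (count_mem j r)%:R - (count_mem k r)%:R.
Proof.
elim: r => [|s r IH]; first by rewrite big_nil subrr.
by rewrite big_cons IH /step /= !natrD opprD addrACA.
Qed.

Lemma step_sqr s : step s ^+ 2 = (s == j)%:R + (s == k)%:R.
Proof.
rewrite /step; case: (eqVneq s j) => [->|_].
  by rewrite (negbTE jk) subr0 addr0 expr1n.
by case: eqP => _; rewrite sub0r sqrrN add0r ?expr1n ?expr0n.
Qed.

Lemma step_cube s : step s ^+ 3 = step s.
Proof.
rewrite exprSr step_sqr /step; case: (eqVneq s j) => [->|_].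
  by rewrite (negbTE jk) subr0 addr0 mulr1.
by case: eqP => _ /=; ring.
Qed.

Let mean_pred1 (i : S) : mean (fun s => (s == i)%:R : R) = #|S|%:R^-1.
Proof. by rewrite (mean_indic _ (pred1 i)) card1 mul1r. Qed.

Lemma mean_step : mean step = 0.
Proof.
rewrite (eq_mean _ _ (fun s => (s == j)%:R + -1 * (s == k)%:R)) => [|s].
  by rewrite meanD meanZ !mean_pred1; ring.
by rewrite mulN1r.
Qed.

Lemma mean_step_sqr : mean (fun s => step s ^+ 2) = 2 / #|S|%:R.
Proof. by rewrite (eq_mean _ _ _ step_sqr) meanD !mean_pred1; ring. Qed.

Lemma mean_step_pow4 : mean (fun s => step s ^+ 4) = 2 / #|S|%:R.
Proof.
by rewrite -mean_step_sqr; apply: eq_mean => s; rewrite exprSr step_cube.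
Qed.

(** The excess of letters $j$ over letters $k$ in a uniform word of length $n$
    has variance $2 \lambda$ with $\lambda = n / |S|$, and fourth moment at most
    $14 \lambda^2$ once $\lambda \ge 1$. *)
Lemma count_diff_large n : (0 < #|S| <= n)%N ->
  1 / 14 <= mean (fun t : n.-tuple S =>
    (n%:R / #|S|%:R <= ((count_mem j t)%:R - (count_mem k t)%:R) ^+ 2 :> R)%R%:R)
    :> R.
Proof.
case/andP => S0 Sn; set lam : R := n%:R / #|S|%:R.
have SR0 : 0 < #|S|%:R :> R by rewrite ltr0n.
have lam1 : 1 <= lam by rewrite ler_pdivlMr// mul1r ler_nat.
have mean3 : mean (fun s => step s ^+ 3) = 0.
  by rewrite (eq_mean _ _ _ step_cube) mean_step.
set Y := fun t : n.-tuple S => (\sum_(s <- t) step s) ^+ 2.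
rewrite (eq_mean _ _ (fun t => (lam <= Y t)%R%:R)) => [|t]; last first.
  by rewrite /Y sum_step.
set p := mean _; have EY : mean Y = 2 * lam.
  by rewrite mean_sum_sqr ?mean_step// mean_step_sqr /lam; ring.
have EY2 : mean (fun t => Y t ^+ 2) <= 14 * lam ^+ 2.
  rewrite (eq_mean _ _ (fun t : n.-tuple S => (\sum_(s <- t) step s) ^+ 4)) => [|t].
    rewrite mean_sum_pow4 ?mean_step// mean_step_pow4 mean_step_sqr.
    have -> : n%:R * (2 / #|S|%:R) + 3 * n%:R * (n%:R - 1) * (2 / #|S|%:R) ^+ 2 =
        2 * lam + 12 * lam ^+ 2 - 12 * lam / #|S|%:R.
      by rewrite /lam; field; rewrite gt_eqF.
    have : 0 <= lam / #|S|%:R by rewrite divr_ge0 ?ltW// (lt_le_trans ltr01).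
    by rewrite -mulrA; nra.
  by rewrite /Y -exprM.
have tuple_gt0 : (0 < #|{: n.-tuple S}|)%N by rewrite card_tuple expn_gt0 S0.
have lam0 : 0 <= lam by lra.
have := paley_zygmund _ Y lam tuple_gt0 lam0; rewrite EY.
have -> : 2 * lam - lam = lam by ring.
have le2 : lam <= 2 * lam by lra.
move=> /(_ le2); rewrite -/p => h.
have p0 : 0 <= p by rewrite mulr_ge0 ?invr_ge0 ?ler0n// sumr_ge0.
have {}h := le_trans h (ler_wpM2l p0 EY2).
have l2 : 0 < lam ^+ 2 by rewrite exprn_gt0// (lt_le_trans ltr01).
rewrite -(ler_pM2r l2); lra.
Qed.

End CountDifference.

Theorem proposition26 (R : realType) (disp : measure_display)
    (T : measurableType disp) (P : probability T R)
    (d N : nat) (x : 'rV[R]_d) (D : nat -> T -> 'I_d)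
    (hd : (2 <= d)%N) (hx : in_hrect x (unit_cube R d)) (hN : (d <= N)%N)
    (Drv : discrete_rvs D) (Dindep : mutually_independent P D)
    (Dunif : uniformly_distributed P D) :
  ((1 / 14 : R)%:E <=
    P [set w | (h_plus (cell x (fun i => D i w) N) /
                h_minus (cell x (fun i => D i w) N) >=
                2 `^ Num.sqrt (N%:R / d%:R))%R])%E.
Proof.
pose j0 := Ordinal (ltnW hd : (0 < d)%N); pose j1 := Ordinal (hd : (1 < d)%N).
pose Q (dir : nat -> 'I_d) := 2 `^ Num.sqrt (N%:R / d%:R) <=
  h_plus (cell x dir N) / h_minus (cell x dir N).
(* The cell depends on the first N directions only, so the event can be read
   off the random word of length N; the default letter j0 is never reached. *)
have -> : [set w | Q (D^~ w)] =
    [set w | Q (nth j0 [tuple D i w | i < N])].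
  have congr_cell w :
      cell x (D^~ w) N = cell x (nth j0 [tuple D i w | i < N]) N.
    by apply: cell_congr => i iN; rewrite -(tnth_nth _ _ (Ordinal iN)) tnth_mktuple.
  by apply/seteqP; split => w; rewrite /Q /= congr_cell.
rewrite (probability_tuple P D Drv Dindep Dunif N (fun t => Q (nth j0 t))).
rewrite lee_fin -mean_indic.
have d_gt0 : (0 < #|'I_d| <= N)%N by rewrite card_ord hN ltnW.
apply: le_trans (count_diff_large j0 j1 isT N d_gt0) _.
apply: ler_mean => t; rewrite ler_nat card_ord.
case: (boolP (_ <= _ ^+ 2)) => //= far; suff -> : Q (nth j0 t) by [].
have tE : mkseq (nth j0 t) N = t by rewrite -{2}(size_tuple t) mkseq_nth.
have := shape_ge x (nth j0 t) N j0 j1; have := shape_ge x (nth j0 t) N j1 j0.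
rewrite tE => ge10 ge01.
move: far; rewrite -ler_sqrt ?sqr_ge0// sqrtr_sqr ler_normr opprB.
by case/orP => far; [apply: le_trans ge01|apply: le_trans ge10];
  rewrite ler_powR// ler1n.
Qed.
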